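(* Let $p:\mathcal C\to\mathcal D$ be a fibration and $K$ a Grothendieck topology on $\mathcal D$. Then a sieve $R$ in $\mathcal C$ is $M^p_K$-covering if and only if the collection of cartesian arrows belonging to $R$ is sent by $p$ to a $K$-covering family, where $M^p_K$ is the smallest Grothendieck topology on $\mathcal C$ making $p$ a comorphism of sites to $(\mathcal D,K)$.
   Context: For a functor $p:\mathcal C\to\mathcal D$, an arrow $\phi:c'\to c$ of $\mathcal C$ is cartesian if for any arrow $\psi:c''\to c$ in $\mathcal C$ and any $g:p(c'')\to p(c')$ with $p(\phi)\circ g=p(\psi)$ there is a unique $\chi:c''\to c'$ with $\phi\circ\chi=\psi$ and $p(\chi)=g$. The functor $p$ is a fibration (in the sense of Street) if for every arrow $f:d\to p(c)$ in $\mathcal D$ there are a cartesian arrow $\phi:c'\to c$ and an isomorphism $\alpha:p(c')\to d$ with $f\circ\alpha=p(\phi)$. A comorphism of sites $(\mathcal C,J)\to(\mathcal D,K)$ is a functor $p:\mathcal C\to\mathcal D$ such that for every object $c$ and every $K$-covering sieve $S$ on $p(c)$ there is a $J$-covering sieve $R$ on $c$ with $p(R)\subseteq S$. The topology $M^p_K$ is generated by the sieves $\{f:\mathrm{dom}(f)\to c\mid p(f)\in T\}$, for $c\in\mathcal C$ and $T$ a $K$-covering sieve on $p(c)$. A family of arrows with common codomain is $K$-covering if the sieve it generates is. *)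

(* Defs.v *)
Record Category := {
  Obj :> Type;
  Hom : Obj -> Obj -> Type;
  idm : forall a, Hom a a;
  comp : forall {a b c}, Hom b c -> Hom a b -> Hom a c;
  comp_id_l : forall a b (f : Hom a b), comp (idm b) f = f;
  comp_id_r : forall a b (f : Hom a b), comp f (idm a) = f;
  comp_assoc : forall a b c d (h : Hom c d) (g : Hom b c) (f : Hom a b),
      comp h (comp g f) = comp (comp h g) f }.

Arguments Hom {_} _ _.
Arguments idm {_} _.
Arguments comp {_ a b c} _ _.

Declare Scope cat_scope.
Notation "g ∘ f" := (comp g f) (at level 40, left associativity) : cat_scope.
Open Scope cat_scope.

Record Functor (C D : Category) := {
  fobj :> C -> D;
  fmap : forall {a b : C}, Hom a b -> Hom (fobj a) (fobj b);
  fmap_id : forall a : C, fmap (idm a) = idm (fobj a);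
  fmap_comp : forall (a b c : C) (g : Hom b c) (f : Hom a b),
      fmap (g ∘ f) = fmap g ∘ fmap f }.

Arguments fmap {C D} _ {a b} _.

Definition is_iso {C : Category} {a b : C} (f : Hom a b) : Prop :=
  exists g : Hom b a, g ∘ f = idm a /\ f ∘ g = idm b.

Definition cartesian {C D : Category} (p : Functor C D) {c' c : C}
    (phi : Hom c' c) : Prop :=
  forall (c'' : C) (psi : Hom c'' c) (g : Hom (p c'') (p c')),
    fmap p phi ∘ g = fmap p psi ->
    exists! chi : Hom c'' c', phi ∘ chi = psi /\ fmap p chi = g.

Definition fibration {C D : Category} (p : Functor C D) : Prop :=
  forall (c : C) (d : D) (f : Hom d (p c)),
    exists (c' : C) (phi : Hom c' c) (alpha : Hom (p c') d),
      cartesian p phi /\ is_iso alpha /\ f ∘ alpha = fmap p phi.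

Definition Family {C : Category} (c : C) := forall d : C, Hom d c -> Prop.

Record Sieve {C : Category} (c : C) := {
  arrows :> Family c;
  arrows_comp : forall (d e : C) (f : Hom d c) (g : Hom e d),
      arrows d f -> arrows e (f ∘ g) }.

Arguments arrows {C c} _ {d} _.
Arguments arrows_comp {C c} _ {d e f} _ _.

Definition max_sieve {C : Category} (c : C) : Sieve c.
Proof.
  refine {| arrows := fun d (f : Hom d c) => True |}.
  exact (fun _ _ _ _ _ => I).
Defined.

Definition pullback_sieve {C : Category} {c d : C} (f : Hom d c) (S : Sieve c) :
  Sieve d.
Proof.
  refine {| arrows := fun e (g : Hom e d) => arrows S (f ∘ g) |}.
  intros e e' g h Hg. rewrite comp_assoc. now apply arrows_comp.
Defined.

Definition generated_sieve {C : Category} {c : C} (F : Family c) : Sieve c.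
Proof.
  refine {| arrows := fun e (h : Hom e c) =>
    exists (d : C) (f : Hom d c) (g : Hom e d), F d f /\ h = f ∘ g |}.
  intros e e' h k (d & f & g & Hf & ->).
  exists d, f, (g ∘ k). split; [exact Hf | now rewrite comp_assoc].
Defined.

Definition preimage_sieve {C D : Category} (p : Functor C D) {c : C}
    (T : Sieve (p c)) : Sieve c.
Proof.
  refine {| arrows := fun d (f : Hom d c) => arrows T (fmap p f) |}.
  intros d e f g Hf. rewrite fmap_comp. now apply arrows_comp.
Defined.

(** The direct image is inductive because an arrow [h : Hom e (p c)] can only be
    compared with [fmap p f] once [e] is of the form [p d]. *)
Inductive image_family {C D : Category} (p : Functor C D) {c : C}
    (F : Family c) : Family (p c) :=
| image_family_intro : forall (d : C) (f : Hom d c),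
    F d f -> image_family p F (p d) (fmap p f).

Definition cartesian_arrows {C D : Category} (p : Functor C D) {c : C}
    (R : Sieve c) : Family c :=
  fun d f => arrows R f /\ cartesian p f.

Record Topology (C : Category) := {
  covers : forall {c : C}, Sieve c -> Prop;
  covers_max : forall c : C, covers (max_sieve c);
  covers_pullback : forall (c d : C) (f : Hom d c) (S : Sieve c),
      covers S -> covers (pullback_sieve f S);
  covers_trans : forall (c : C) (S R : Sieve c),
      covers S ->
      (forall (d : C) (f : Hom d c), arrows S f -> covers (pullback_sieve f R)) ->
      covers R }.

Arguments covers {C} _ {c} _.
Arguments covers_pullback {C} _ {c d} _ {S} _.
Arguments covers_trans {C} _ {c S R} _ _.

Definition covers_family {C : Category} (J : Topology C) {c : C} (F : Family c) :
  Prop := covers J (generated_sieve F).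

Definition topology_le {C : Category} (J J' : Topology C) : Prop :=
  forall (c : C) (S : Sieve c), covers J S -> covers J' S.

Definition smallest_topology {C : Category} (P : Topology C -> Prop)
    (J : Topology C) : Prop :=
  P J /\ forall J' : Topology C, P J' -> topology_le J J'.

(** The intersection of all topologies for which the sieves of [G] are covering. *)
Definition generated_topology {C : Category}
    (G : forall c : C, Sieve c -> Prop) : Topology C.
Proof.
  refine {| covers := fun (c : C) (S : Sieve c) =>
    forall J : Topology C,
      (forall (c' : C) (S' : Sieve c'), G c' S' -> covers J S') -> covers J S |}.
  - intros c J _. apply covers_max.
  - intros c d f S HS J HJ. apply covers_pullback. now apply HS.
  - intros c S R HS HR J HJ. apply (covers_trans J (S := S)).
    + now apply HS.
    + intros d f Hf. now apply HR.
Defined.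

Definition comorphism_of_sites {C D : Category} (J : Topology C) (K : Topology D)
    (p : Functor C D) : Prop :=
  forall (c : C) (S : Sieve (p c)), covers K S ->
    exists R : Sieve c, covers J R /\
      forall (d : C) (f : Hom d c), arrows R f -> arrows S (fmap p f).

Inductive preimage_sieves {C D : Category} (p : Functor C D) (K : Topology D) :
  forall c : C, Sieve c -> Prop :=
| preimage_sieves_intro : forall (c : C) (T : Sieve (p c)),
    covers K T -> preimage_sieves p K c (preimage_sieve p T).

(** The topology written [M^p_K]. *)
Definition induced_topology {C D : Category} (p : Functor C D) (K : Topology D) :
  Topology C := generated_topology (preimage_sieves p K).

(* Main.v *)
(** For a fibration [p], a sieve [R] on [c] has its cartesian arrows sent to a
    [K]-covering family iff [R] contains the preimage of some [K]-covering sieve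
    on [p c]: an arrow whose image factors through [p] of a cartesian arrow of [R]
    factors through that arrow, and conversely each arrow of the covering sieve
    lifts, up to isomorphism, to a cartesian arrow of [R].  The sieves satisfying
    this condition form a Grothendieck topology: stability under pullback is clear
    on the second form, transitivity follows on the first since cartesian arrows
    compose. *)

From Stdlib Require Import FunctionalExtensionality PropExtensionality ProofIrrelevance.
Require Import Defs.

Lemma sieve_ext {C : Category} (c : C) (S R : Sieve c) :
  (forall (d : C) (f : Hom d c), arrows S f <-> arrows R f) -> S = R.
Proof.
  destruct S as [S HS], R as [R HR]; cbn; intros H.
  assert (E : S = R).
  { extensionality d; extensionality f; apply propositional_extensionality, H. }
  subst R; f_equal; apply proof_irrelevance.
Qed.

(** Transitivity applies because [R] pulls back to the maximal sieve along each arrow of [S]. *)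
Lemma covers_mono {C : Category} (J : Topology C) (c : C) (S R : Sieve c) :
  (forall (d : C) (f : Hom d c), arrows S f -> arrows R f) ->
  covers J S -> covers J R.
Proof.
  intros H HS; apply (covers_trans J HS); intros d f Hf.
  replace (pullback_sieve f R) with (max_sieve d); [apply covers_max|].
  apply sieve_ext; intros e g; cbn; split; [intros _|trivial].
  now apply arrows_comp, H.
Qed.

Lemma cartesian_comp {C D : Category} (p : Functor C D) (a b c : C)
    (phi : Hom b c) (psi : Hom a b) :
  cartesian p phi -> cartesian p psi -> cartesian p (phi ∘ psi).
Proof.
  intros Hphi Hpsi x f g Hg.
  rewrite fmap_comp, <- comp_assoc in Hg.
  destruct (Hphi _ _ _ Hg) as (u & (Hu1 & Hu2) & Uu).
  destruct (Hpsi _ u g (eq_sym Hu2)) as (v & (Hv1 & Hv2) & Uv).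
  exists v; split.
  - split; [|exact Hv2].
    now rewrite <- comp_assoc, Hv1.
  - intros w (Hw1 & Hw2); apply Uv; split; [|exact Hw2].
    symmetry; apply Uu; split.
    + now rewrite comp_assoc.
    + now rewrite fmap_comp, Hw2.
Qed.

Lemma arrows_of_image_cartesian {C D : Category} (p : Functor C D) (c : C)
    (R : Sieve c) (d : C) (f : Hom d c) :
  arrows (generated_sieve (image_family p (cartesian_arrows p R))) (fmap p f) ->
  arrows R f.
Proof.
  intros (e & h & g & Hh & E).
  destruct Hh as [e phi [HR Hphi]].
  destruct (Hphi _ f g (eq_sym E)) as (chi & (<- & _) & _).
  now apply arrows_comp.
Qed.

Lemma covers_image_cartesian_iff {C D : Category} (p : Functor C D)
    (K : Topology D) (Hp : fibration p) (c : C) (R : Sieve c) :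
  covers_family K (image_family p (cartesian_arrows p R)) <->
  exists T : Sieve (p c), covers K T /\
    forall (d : C) (f : Hom d c), arrows T (fmap p f) -> arrows R f.
Proof.
  split.
  - intros H; eexists; split; [exact H|].
    intros d f; apply arrows_of_image_cartesian.
  - intros (T & HT & HTR); revert HT; apply covers_mono; intros d f Hf.
    destruct (Hp c d f) as (c' & phi & alpha & Hphi & (beta & _ & Hab) & E).
    (* [phi] lies in [R] since [fmap p phi] equals [f ∘ alpha], which is in [T]; the inverse [beta]
       of [alpha] then recovers [f]. *)
    exists (p c'), (fmap p phi), beta; split.
    + constructor; split; [|exact Hphi].
      apply HTR; rewrite <- E; now apply arrows_comp.
    + now rewrite <- E, <- comp_assoc, Hab, comp_id_r.
Qed.

Definition cartesian_topology {C D : Category} (p : Functor C D)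
    (K : Topology D) (Hp : fibration p) : Topology C.
Proof.
  refine {| covers := fun (c : C) (R : Sieve c) =>
    covers_family K (image_family p (cartesian_arrows p R)) |}.
  - intros c; apply covers_image_cartesian_iff; [exact Hp|].
    exists (max_sieve (p c)); split; [apply covers_max | trivial].
  - intros c d f S HS; apply covers_image_cartesian_iff in HS; [|exact Hp].
    destruct HS as (T & HT & HTS).
    apply covers_image_cartesian_iff; [exact Hp|].
    exists (pullback_sieve (fmap p f) T).
    split; [now apply covers_pullback|].
    intros e g Hg; apply HTS; now rewrite fmap_comp.
  - intros c S R HS HR; apply (covers_trans K HS).
    intros e h (d & f & k & Hf & ->).
    destruct Hf as [d f [HfS Hf]].
    (* The cover of [p d] given by [HR] is moved along [k]; its generators come from cartesian [g]
       with [f ∘ g] in [R], and [f ∘ g] is cartesian because [f] is. *)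
    generalize (covers_pullback K k (HR d f HfS)); apply covers_mono.
    intros x u (y & g & v & Hg & E); cbn in E.
    destruct Hg as [y g [HgR Hg]].
    exists (p y), (fmap p (f ∘ g)), v; split.
    + constructor; split; [exact HgR | now apply cartesian_comp].
    + now rewrite fmap_comp, <- !comp_assoc, E.
Defined.

Lemma induced_topology_smallest {C D : Category} (p : Functor C D)
    (K : Topology D) :
  smallest_topology (fun J : Topology C => comorphism_of_sites J K p)
    (induced_topology p K).
Proof.
  split.
  - intros c S HS; exists (preimage_sieve p S); split; [|trivial].
    intros J HJ; now apply HJ.
  - intros J HJ c S HS; apply HS; intros _ _ [c' T HT].
    destruct (HJ c' T HT) as (R & HR & HRT).
    (* The sieve [R] given by the comorphism property lies inside the preimage of [T], so every
       generator is [J]-covering. *)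
    now apply (covers_mono J c' R).
Qed.

Theorem theorem3p13 (C D : Category) (p : Functor C D) (K : Topology D)
    (Hp : fibration p) :
  smallest_topology (fun J : Topology C => comorphism_of_sites J K p)
    (induced_topology p K) /\
  forall (c : C) (R : Sieve c),
    covers (induced_topology p K) R <->
    covers_family K (image_family p (cartesian_arrows p R)).
Proof.
  split; [apply induced_topology_smallest|].
  intros c R; split.
  (* The induced topology is an intersection, so it suffices that [cartesian_topology] contains the
     generators. *)
  - intros HR; apply (HR (cartesian_topology p K Hp)).
    intros _ _ [c' T HT]; apply covers_image_cartesian_iff; [exact Hp|].
    now exists T.
  - intros HR J HJ.
    (* This preimage is itself one of the generators, and it is contained in [R]. *)
    apply (covers_mono J c (preimage_sieve p
      (generated_sieve (image_family p (cartesian_arrows p R))))).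
    + intros d f; apply arrows_of_image_cartesian.
    + apply HJ; now constructor.
Qed.
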